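(* There are infinitely many positive integers $n$ such that, among the subsets of $D_n=\{d\geqslant 2: d\mid n\}$, only $D_n$ itself can be the set of all the moduli in a cover of $\mathbb{Z}$ with distinct moduli; that is, $D_n$ is the set of all moduli of some cover of $\mathbb{Z}$ with distinct moduli, while no proper subset of $D_n$ is the set of all moduli of a cover of $\mathbb{Z}$ with distinct moduli.
   Context: For $a\in\mathbb{Z}$ and a positive integer $n$, $a(\mathrm{mod}\ n)=\{a+nx: x\in\mathbb{Z}\}$ is the residue class with modulus $n$. A finite system of residue classes $\{a_i(\mathrm{mod}\ n_i)\}_{i=1}^k$ is a cover of $\mathbb{Z}$ if every integer lies in at least one of the classes $a_i(\mathrm{mod}\ n_i)$; the integers $n_1,\ldots,n_k$ are its moduli. The cover has distinct moduli if $n_1,\ldots,n_k$ are pairwise distinct. *)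

(* Defs.v *)
From mathcomp Require Import all_boot all_order all_algebra.
From mathcomp Require Import boolp classical_sets functions cardinality.

Set Implicit Arguments.
Unset Strict Implicit.
Unset Printing Implicit Defensive.

Import Order.TTheory GRing.Theory Num.Theory.

Local Open Scope classical_set_scope.
Local Open Scope ring_scope.

Definition residue_class (a : int) (n : nat) : set int :=
  [set a + n%:Z * x | x in [set: int]].

Definition is_cover (k : nat) (a : 'I_k -> int) (n : 'I_k -> nat) : Prop :=
  (forall i, (0 < n i)%N) /\
  (forall z : int, exists i, residue_class (a i) (n i) z).

Definition distinct_cover_moduli (S : set nat) : Prop :=
  exists (k : nat) (a : 'I_k -> int) (n : 'I_k -> nat),
    [/\ is_cover a n, injective n & range n = S].

Definition nontrivial_divisors (n : nat) : set nat :=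
  [set d : nat | (2 <= d)%N /\ (d %| n)%N].

(* Main.v *)
(* The witnesses are n = 2^(p-1) p with p an odd prime; the divisors of n are
   2^j and 2^j p with j < p.
   Covering with all of D_n: the class of 2^(j-1) modulo 2^j, for 0 < j < p,
   leaves exactly the multiples of 2^(p-1), and the p classes of 2^(p-1) j
   modulo 2^j p take care of these according to their residue modulo p.
   Minimality: classes modulo distinct powers 2^j never cover Z.  If x is left
   uncovered by them, then so is the progression x + 2^(p-1) Z; each modulus
   2^j p accounts for only one residue class modulo p of that progression, so
   all p of them occur, and all of them meet it.  In particular the one with
   j = p - 1 determines x modulo 2^(p-1).  If some 2^j with 0 < j < p were
   missing, there would be two values of x distinct modulo 2^(p-1). *)
Require Import Defs.
From mathcomp Require Import all_boot all_order all_algebra.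
From mathcomp Require Import boolp classical_sets functions cardinality.
From mathcomp Require Import ring.

Set Implicit Arguments.
Unset Strict Implicit.
Unset Printing Implicit Defensive.

Import Order.TTheory GRing.Theory Num.Theory.

Local Open Scope classical_set_scope.

Lemma residue_classP (a : int) (n : nat) (z : int) :
  residue_class a n z <-> (n%:Z %| (z - a)%R)%Z.
Proof.
split=> [[x _ <-]|/dvdzP[x zE]].
  by rewrite addrAC subrr add0r dvdz_mulr.
by exists x => //; rewrite mulrC -zE addrC subrK.
Qed.

(** Distinct moduli let each residue be indexed by its modulus, so the index type disappears; [b]
    takes the dummy value 0 off the moduli. *)
Lemma distinct_cover_moduliP (S : set nat) : distinct_cover_moduli S ->
  exists b : nat -> int,
    forall z : int, exists2 d, S d & (d%:Z %| (z - b d)%R)%Z.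
Proof.
move=> [k [a [n [[_ cov] ninj nS]]]].
have /choice[b bP] d : exists c, forall i, n i = d -> a i = c.
  have [[i <-]|nd] := pselect (exists i, n i = d).
    by exists (a i) => j /ninj ->.
  by exists 0%R => i di; case: nd; exists i.
exists b => z; have [i /residue_classP zi] := cov z.
by exists (n i); [rewrite -nS; exists i | rewrite -(bP _ i)].
Qed.

Lemma seq_distinct_cover_moduli (s : seq nat) (b : nat -> int) : uniq s ->
  (forall d, d \in s -> (0 < d)%N) ->
  (forall z : int, exists2 d, d \in s & (d%:Z %| (z - b d)%R)%Z) ->
  distinct_cover_moduli [set` s].
Proof.
move=> s_uniq s_gt0 cov.
exists (size s), (fun i => b (nth 0%N s i)), (fun i => nth 0%N s i); split.
- split=> [i|z]; first by apply: s_gt0; exact: mem_nth.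
  have [d ds zd] := cov z; have ids : (index d s < size s)%N by rewrite index_mem.
  by exists (Ordinal ids); apply/residue_classP; rewrite nth_index.
- by move=> i j /eqP; rewrite nth_uniq// => /eqP/val_inj.
- apply/seteqP; split=> [_ [i _ <-]|d /= ds]; first exact: mem_nth.
  have ids : (index d s < size s)%N by rewrite index_mem.
  by exists (Ordinal ids) => //=; rewrite nth_index.
Qed.

Lemma dvdn_exp2_prime (m p d : nat) : prime p -> (d %| 2 ^ m * p)%N ->
  exists2 e, (e <= m)%N & d = (2 ^ e)%N \/ d = (2 ^ e * p)%N.
Proof.
move=> pp; have [/dvdnP[c ->]|pd] := boolP (p %| d)%N.
  rewrite dvdn_pmul2r ?prime_gt0// => /(dvdn_pfactor _ _ (isT : prime 2)).
  by move=> [e em ->]; exists e => //; right.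
rewrite Gauss_dvdl; last by rewrite coprime_sym prime_coprime.
by move=> /(dvdn_pfactor _ _ (isT : prime 2))[e em ->]; exists e => //; left.
Qed.

Lemma dvdz_exp2_subset (i j : nat) (z : int) : (i <= j)%N ->
  ((2 ^ j)%N%:Z %| z)%Z -> ((2 ^ i)%N%:Z %| z)%Z.
Proof. by move=> ij; apply: dvdz_trans; rewrite dvdzE /= dvdn_exp2l. Qed.

Lemma ndvdz_exp2 (j : nat) : ~~ ((2 ^ j.+1)%N%:Z %| (2 ^ j)%N%:Z)%Z.
Proof. by rewrite dvdzE /= dvdn_Pexp2l// ltnn. Qed.

(** Induction on [m]: if z = 2^m y, the parity of y decides between divisibility by 2^(m+1) and the
    class of 2^m modulo 2^(m+1). *)
Lemma dvdz_exp2_or (m : nat) (z : int) :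
  ((2 ^ m)%N%:Z %| z)%Z \/
  exists2 j, (j < m)%N & ((2 ^ j.+1)%N%:Z %| (z - (2 ^ j)%N%:Z)%R)%Z.
Proof.
elim: m => [|m [/dvdzP[y zE]|[j jm zj]]]; first by left.
- have yE := divz_eq y 2.
  have : ((y %% 2)%Z == 0%R) || ((y %% 2)%Z == 1%R).
    have := modz_ge0 y (isT : (2%:Z)%R != 0%R).
    have := ltz_pmod y (isT : (0 < (2%:Z))%R).
    by case: (y %% 2)%Z => [[|[|]]|].
  case/orP=> /eqP yr; rewrite yr in yE.
    left; apply/dvdzP; exists (y %/ 2)%Z.
    by rewrite zE {1}yE expnS PoszM; ring.
  right; exists m => //; apply/dvdzP; exists (y %/ 2)%Z.
  by rewrite zE {1}yE expnS PoszM; ring.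
- by right; exists j => //; apply: leq_trans jm _.
Qed.

Lemma full_cover (p : nat) : prime p -> (2 < p)%N ->
  distinct_cover_moduli (nontrivial_divisors (2 ^ p.-1 * p)).
Proof.
move=> pp p_gt2; set n := (2 ^ p.-1 * p)%N.
have p_gt0 := prime_gt0 pp.
have n_gt0 : (0 < n)%N by rewrite muln_gt0 expn_gt0.
have cop2 j : coprime p (2 ^ j).
  by rewrite coprime_sym coprimeXl// coprime_sym prime_coprime// gtnNdvd.
have pN2 j : ~~ (p %| 2 ^ j)%N by rewrite -prime_coprime.
pose s := [seq d <- divisors n | (1 < d)%N].
have -> : nontrivial_divisors n = [set` s].
  apply/seteqP; split=> d /=; rewrite mem_filter -dvdn_divisors//.
    by case=> -> ->.
  by case/andP.
(* For d = 2^e p, [logn 2 d] recovers e because p is odd; for d = 2^(j+1), halving gives 2^j. *)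
pose b d : int := if (p %| d)%N then (2 ^ p.-1 * logn 2 d)%N else (d %/ 2)%N.
apply: (@seq_distinct_cover_moduli s b).
- by rewrite filter_uniq// divisors_uniq.
- by move=> d; rewrite mem_filter => /andP[/ltnW].
move=> z; have [/dvdzP[y zE]|[j jp zj]] := dvdz_exp2_or p.-1 z; last first.
  exists (2 ^ j.+1)%N.
    rewrite mem_filter -dvdn_divisors// -[X in (X < _)%N](expn0 2) ltn_exp2l//=.
    by apply: dvdn_mulr; rewrite dvdn_exp2l.
  by rewrite /b (negbTE (pN2 _)) expnS mulKn// -expnS.
have pZ0 : (p%:Z != 0)%R by rewrite eqz_nat -lt0n.
have := ltz_pmod y (p_gt0 : (0 < p%:Z)%R); have := modz_ge0 y pZ0.
have := divz_eq y p%:Z; case: (y %% p%:Z)%Z => [e|//] yE _; rewrite ltz_nat => ep.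
have ep1 : (e <= p.-1)%N by rewrite -ltnS prednK.
(* The residue e of y modulo p selects the modulus: z - 2^(p-1) e is a multiple of 2^(p-1) p, and e
   <= p-1. *)
exists (2 ^ e * p)%N.
  rewrite mem_filter -dvdn_divisors// dvdn_pmul2r// dvdn_exp2l// andbT.
  by rewrite (leq_trans (ltnW p_gt2))// leq_pmull// expn_gt0.
rewrite /b dvdn_mull// lognM ?expn_gt0// pfactorK//.
rewrite [logn 2 p](_ : _ = 0%N) ?addn0; last first.
  by apply/eqP; rewrite -leqn0 leqNgt logn_gt0 mem_primes p_gt0 /= dvdn_prime2// ltn_eqF.
apply/dvdzP; exists ((y %/ p%:Z)%Z * (2 ^ (p.-1 - e))%N%:Z)%R.
by rewrite zE {1}yE -{1 2}(subnK ep1) expnD !PoszM; ring.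
Qed.

Definition uncovered2 (S : set nat) (b : nat -> int) (m : nat) (x : int) :=
  forall j, (0 < j <= m)%N -> S (2 ^ j)%N ->
    ~~ ((2 ^ j)%N%:Z %| (x - b (2 ^ j)%N)%R)%Z.

Lemma uncovered2_modz (S : set nat) (b : nat -> int) (m : nat) (x y : int) :
  ((2 ^ m)%N%:Z %| (y - x)%R)%Z -> uncovered2 S b m x -> uncovered2 S b m y.
Proof.
move=> yx ux j /andP[j0 jm] Sj; apply: contra (ux j _ Sj); last by rewrite j0.
rewrite (_ : x - _ = (y - b (2 ^ j)%N) - (y - x))%R; last by ring.
by move=> yj; apply: rpredB => //; exact: dvdz_exp2_subset yx.
Qed.

Lemma uncovered2_skip (S : set nat) (b : nat -> int) (m : nat) (x : int) :
  ~ S (2 ^ m.+1)%N -> uncovered2 S b m x -> uncovered2 S b m.+1 x.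
Proof.
move=> Sm ux j /andP[j0]; rewrite leq_eqVlt => /predU1P[->//|jm].
by apply: ux; rewrite j0.
Qed.

(** One class modulo 2^(m+1) cannot contain both x and x + 2^m, and these agree modulo 2^m, so one
    of them serves as y. *)
Lemma uncovered2_step (S : set nat) (b : nat -> int) (m : nat) (x : int) :
  uncovered2 S b m x ->
  exists2 y : int, ((2 ^ m)%N%:Z %| (y - x)%R)%Z & uncovered2 S b m.+1 y.
Proof.
move=> ux; set c := b (2 ^ m.+1)%N.
have extend (y : int) : ((2 ^ m)%N%:Z %| (y - x)%R)%Z ->
    ~~ ((2 ^ m.+1)%N%:Z %| (y - c)%R)%Z -> uncovered2 S b m.+1 y.
  move=> yx yc j /andP[j0]; rewrite leq_eqVlt => /predU1P[->//|jm].
  by apply: (uncovered2_modz yx ux); rewrite j0.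
have [xc|xc] := boolP ((2 ^ m.+1)%N%:Z %| (x - c)%R)%Z; last first.
  by exists x; [|apply: extend => //]; rewrite subrr dvdz0.
have yx : ((2 ^ m)%N%:Z %| ((x + (2 ^ m)%N%:Z) - x)%R)%Z by rewrite addrAC subrr add0r.
exists (x + (2 ^ m)%N%:Z)%R => //; apply: extend => //.
apply: contra (ndvdz_exp2 m) => yc.
rewrite (_ : (2 ^ m)%N%:Z = (x + (2 ^ m)%N%:Z - c) - (x - c))%R; last by ring.
exact: rpredB.
Qed.

Lemma uncovered2_extend (S : set nat) (b : nat -> int) (m n : nat) (x : int) :
  (m <= n)%N -> uncovered2 S b m x ->
  exists2 y : int, ((2 ^ m)%N%:Z %| (y - x)%R)%Z & uncovered2 S b n y.
Proof.
move=> /subnK <- ux; elim: (n - m)%N => [|k [y yx uy]].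
  by exists x => //; rewrite subrr dvdz0.
have [z zy uz] := uncovered2_step uy; exists z => //.
rewrite (_ : z - x = (z - y) + (y - x))%R; last by ring.
by apply: rpredD => //; apply: dvdz_exp2_subset zy; exact: leq_addl.
Qed.

Lemma uncovered2_exists (S : set nat) (b : nat -> int) (m : nat) :
  exists x, uncovered2 S b m x.
Proof.
have u0 : uncovered2 S b 0 0%R by case.
by have [x _ ux] := uncovered2_extend (leq0n m) u0; exists x.
Qed.

(** With 2^(j+1) missing, both lifts x and x + 2^j of an x uncovered up to level j survive to level
    j+1. Extending them to level m keeps their distinct residues modulo 2^(j+1). *)
Lemma uncovered2_two (S : set nat) (b : nat -> int) (m j : nat) :
  (j < m)%N -> ~ S (2 ^ j.+1)%N ->
  exists x y, [/\ uncovered2 S b m x, uncovered2 S b m y &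
                  ~~ ((2 ^ m)%N%:Z %| (x - y)%R)%Z].
Proof.
move=> jm Sj; have [x ux] := uncovered2_exists S b j.
have uy : uncovered2 S b j (x + (2 ^ j)%N%:Z)%R.
  by apply: uncovered2_modz ux; rewrite addrAC subrr add0r.
have [x' x'x ux'] := uncovered2_extend jm (uncovered2_skip Sj ux).
have [y' y'y uy'] := uncovered2_extend jm (uncovered2_skip Sj uy).
exists x', y'; split=> //; apply: contra (ndvdz_exp2 j) => xy.
rewrite (_ : (2 ^ j)%N%:Z
  = (x' - x) - (y' - (x + (2 ^ j)%N%:Z)) - (x' - y'))%R; last by ring.
by apply: rpredB; [exact: rpredB|exact: dvdz_exp2_subset xy].
Qed.

(* By pigeonhole, the r-th term of the progression x + 2^(p-1) r, for r < p, is
   covered by the modulus 2^(f r) p for some permutation f. *)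
Lemma uncovered2_forces (p : nat) (S : set nat) (b : nat -> int) (x : int) :
  prime p -> (2 < p)%N -> S `<=` nontrivial_divisors (2 ^ p.-1 * p) ->
  (forall z : int, exists2 d, S d & (d%:Z %| (z - b d)%R)%Z) ->
  uncovered2 S b p.-1 x ->
  forall e, (e < p)%N -> S (2 ^ e * p)%N /\
    ((2 ^ e)%N%:Z %| (x - b (2 ^ e * p)%N)%R)%Z.
Proof.
move=> pp p_gt2 SD cov ux; have p_gt0 := prime_gt0 pp.
pose t (r : 'I_p) : int := (x + (2 ^ p.-1)%N%:Z * (r : nat)%:Z)%R.
have tx r : ((2 ^ p.-1)%N%:Z %| (t r - x)%R)%Z.
  by rewrite /t addrAC subrr add0r dvdz_mulr.
have /choice[f fP] (r : 'I_p) : exists e : 'I_p, S (2 ^ e * p)%N /\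
    ((2 ^ e * p)%N%:Z %| (t r - b (2 ^ e * p)%N)%R)%Z.
  have [d Sd dt] := cov (t r); have [d_gt1 dn] := SD _ Sd.
  have [e ep [dE|dE]] := dvdn_exp2_prime pp dn; rewrite {}dE in Sd d_gt1 dt *.
    (* A power of 2 cannot cover [t r], which is congruent to x modulo 2^(p-1) and hence uncovered
       too. *)
    have e_gt0 : (0 < e <= p.-1)%N by rewrite ep andbT; case: e d_gt1 {ep Sd dt}.
    by case/negP: (uncovered2_modz (tx r) ux e_gt0 Sd).
  by rewrite -ltnS prednK// in ep; exists (Ordinal ep).
have f_inj : injective f.
  move=> r r' ff; have [_ tr] := fP r; have [_] := fP r'; rewrite -ff => tr'.
  (* Two terms in the same class modulo 2^e p agree modulo p; as 2^(p-1) is invertible modulo p, so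
     do r and r'. *)
  have : (p%:Z %| ((2 ^ p.-1)%N%:Z * ((r : nat)%:Z - (r' : nat)%:Z))%R)%Z.
    rewrite (_ : _ * _ = (t r - b (2 ^ f r * p)%N) - (t r' - b (2 ^ f r * p)%N))%R.
      by apply: dvdz_trans (rpredB tr tr'); rewrite dvdzE /= dvdn_mull.
    by rewrite /t; ring.
  rewrite Gauss_dvdzr; last first.
    by rewrite coprimezE /= coprimeXr// prime_coprime// gtnNdvd.
  rewrite -eqz_mod_dvd !modz_nat !modn_small// => /eqP[].
  exact: val_inj.
move=> e ep; have /codomP[r er] := injF_onto f_inj (Ordinal ep).
have [] := fP r; rewrite -er /= => Se te; split=> //.
rewrite (_ : x - _ = (t r - b (2 ^ e * p)%N) - (t r - x))%R; last by ring.
apply: rpredB; first by apply: dvdz_trans te; rewrite dvdzE /= dvdn_mulr.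
by apply: dvdz_exp2_subset (tx r); rewrite -ltnS prednK.
Qed.

Lemma cover_moduli_full (p : nat) (S : set nat) : prime p -> (2 < p)%N ->
  S `<=` nontrivial_divisors (2 ^ p.-1 * p) -> distinct_cover_moduli S ->
  nontrivial_divisors (2 ^ p.-1 * p) `<=` S.
Proof.
move=> pp p_gt2 SD /distinct_cover_moduliP[b cov] d [d_gt1 dn].
have p_gt0 := prime_gt0 pp.
have force := uncovered2_forces pp p_gt2 SD cov.
have [e ep [dE|->]] := dvdn_exp2_prime pp dn; last first.
  have [x ux] := uncovered2_exists S b p.-1.
  by apply: (force x ux e _).1; rewrite -ltnS prednK in ep.
apply: contrapT => Sd; rewrite {}dE in d_gt1 Sd.
case: e => [//|j] in ep d_gt1 Sd.
have [x [y [ux uy /negP[]]]] := uncovered2_two b ep Sd.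
(* The modulus 2^(p-1) p puts x and y in one class modulo 2^(p-1), against their choice. *)
have pp1 : (p.-1 < p)%N by rewrite prednK.
have [_ xb] := force x ux _ pp1; have [_ yb] := force y uy _ pp1.
rewrite (_ : x - y = (x - b (2 ^ p.-1 * p)%N) - (y - b (2 ^ p.-1 * p)%N))%R.
  exact: rpredB.
by ring.
Qed.

Theorem corollary1p3 :
  infinite_set [set n : nat |
    [/\ (0 < n)%N,
        distinct_cover_moduli (nontrivial_divisors n)
      & forall S : set nat, S `<` nontrivial_divisors n ->
          ~ distinct_cover_moduli S]].
Proof.
move=> /finite_seqP[s sE].
(* An odd prime above every element of the supposedly finite set yields a witness that is at least
   p, hence outside the set. *)
have [p p_gt pp] := prime_above (maxn 2 (\max_(n <- s) n)).
rewrite gtn_max in p_gt; have /andP[p_gt2 p_gts] := p_gt.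
have n_ge : (p <= 2 ^ p.-1 * p)%N by rewrite leq_pmull// expn_gt0.
have : [set` s] (2 ^ p.-1 * p)%N.
  rewrite -sE; split; first by rewrite (leq_trans _ n_ge)// prime_gt0.
    exact: full_cover.
  move=> S [SD nDS] covS; apply: nDS.
  exact: cover_moduli_full.
move=> /= ns; have /(leq_trans n_ge) := @leq_bigmax_seq _ s xpredT id _ ns isT.
by rewrite leqNgt p_gts.
Qed.
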